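(* Let $(\mathcal{C},\otimes,1)$ be a semisimple multiring category over $\Bbbk$ with left duals, and let $(\mathcal{D},\otimes,1')$ be a semisimple abelian monoidal category with biexact tensor product such that the unit object is simple. Suppose there is a fully faithful lax monoidal functor $(F:\mathcal{C}\to\mathcal{D},\phi^2,\phi^0)$ such that $\phi^0$ is an epimorphism. Then $\mathcal{C}$ is a ring category.
   Context: $\Bbbk$ is an algebraically closed field; monoidal categories are assumed strict. A multiring category over $\Bbbk$ is a locally finite (finite-dimensional Hom spaces, all objects of finite length) $\Bbbk$-linear abelian monoidal category with bilinear and biexact tensor product; it is a ring category if in addition $\mathrm{End}_{\mathcal{C}}(1)=\Bbbk$. ''With left duals'' means every object has a left dual. An abelian monoidal category is a monoidal category which is abelian with additive tensor product. An abelian category is semisimple if every object is a direct sum of simple objects. A lax monoidal functor $(F,\phi^2,\phi^0)$ is a functor $F:\mathcal{C}\to\mathcal{D}$ with a natural transformation $\phi^2_{X,Y}:F(X)\otimes F(Y)\to F(X\otimes Y)$ and a morphism $\phi^0:1'\to F(1)$ such that $\phi^2_{X,Y\otimes Z}(\mathrm{Id}\otimes\phi^2_{Y,Z})=\phi^2_{X\otimes Y,Z}(\phi^2_{X,Y}\otimes\mathrm{Id})$, $l_{F(X)}=F(l_X)\phi^2_{1,X}(\phi^0\otimes\mathrm{Id})$ and $r_{F(X)}=F(r_X)\phi^2_{X,1}(\mathrm{Id}\otimes\phi^0)$, where $l,r$ are the unit constraints.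
   Formalization: The category C is additionally assumed to be nonzero; for C = 0 the statement fails, since then End(1) = 0 is not k while all the stated hypotheses can hold. *)

(* Defs.v *)
From mathcomp Require Import all_boot all_order all_algebra.

Set Implicit Arguments.
Unset Strict Implicit.
Unset Printing Implicit Defensive.

Import GRing.Theory.
Local Open Scope ring_scope.

(* Every category below is abelian, so the hom sets carry their abelian group
   structure from the start. *)
Record preadditive := Preadditive {
  ob :> Type;
  mor : ob -> ob -> zmodType;
  idmor : forall X, mor X X;
  compm : forall X Y Z, mor Y Z -> mor X Y -> mor X Z;
  compmA : forall X Y Z W (h : mor Z W) (g : mor Y Z) (f : mor X Y),
    compm h (compm g f) = compm (compm h g) f;
  comp1m : forall X Y (f : mor X Y), compm (idmor Y) f = f;
  compm1 : forall X Y (f : mor X Y), compm f (idmor X) = f;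
  compmDl : forall X Y Z (g g' : mor Y Z) (f : mor X Y),
    compm (g + g') f = compm g f + compm g' f;
  compmDr : forall X Y Z (g : mor Y Z) (f f' : mor X Y),
    compm g (f + f') = compm g f + compm g f'
}.

Arguments mor {p} X Y.
Arguments idmor {p} X.
Arguments compm {p X Y Z} g f.

Notation "g \oc f" := (compm g f) (at level 40, left associativity).

Record linear_category (k : fieldType) := LinearCategory {
  lob : Type;
  lhom : lob -> lob -> lmodType k;
  lidm : forall X, lhom X X;
  lcomp : forall X Y Z, lhom Y Z -> lhom X Y -> lhom X Z;
  lcompA : forall X Y Z W (h : lhom Z W) (g : lhom Y Z) (f : lhom X Y),
    lcomp h (lcomp g f) = lcomp (lcomp h g) f;
  lcomp1m : forall X Y (f : lhom X Y), lcomp (lidm Y) f = f;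
  lcompm1 : forall X Y (f : lhom X Y), lcomp f (lidm X) = f;
  lcomp_linearl : forall X Y Z (f : lhom X Y),
    linear (fun g : lhom Y Z => lcomp g f);
  lcomp_linearr : forall X Y Z (g : lhom Y Z),
    linear (fun f : lhom X Y => lcomp g f)
}.

Arguments lhom {k l} X Y.
Arguments lidm {k l} X.
Arguments lcomp {k l X Y Z} g f.

Section LinearToPreadditive.
Variables (k : fieldType) (C : linear_category k).

Let lcompDl (X Y Z : lob C) (g g' : lhom Y Z) (f : lhom X Y) :
  lcomp (g + g') f = lcomp g f + lcomp g' f.
Proof. by have := lcomp_linearl f 1 g g'; rewrite /= !scale1r. Qed.

Let lcompDr (X Y Z : lob C) (g : lhom Y Z) (f f' : lhom X Y) :
  lcomp g (f + f') = lcomp g f + lcomp g f'.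
Proof. by have := lcomp_linearr g 1 f f'; rewrite /= !scale1r. Qed.

Definition preadditive_of_linear : preadditive :=
  @Preadditive (lob C) (fun X Y => lhom X Y : zmodType)
    (@lidm k C) (@lcomp k C) (@lcompA k C) (@lcomp1m k C) (@lcompm1 k C)
    lcompDl lcompDr.

End LinearToPreadditive.

Coercion preadditive_of_linear : linear_category >-> preadditive.

Section Abelian.
Variable A : preadditive.

Definition is_zero (Z : A) : Prop :=
  forall X, (forall f : mor X Z, f = 0) /\ (forall f : mor Z X, f = 0).

Definition mono (X Y : A) (f : mor X Y) : Prop :=
  forall W (g h : mor W X), f \oc g = f \oc h -> g = h.

Definition epi (X Y : A) (f : mor X Y) : Prop :=
  forall Z (g h : mor Y Z), g \oc f = h \oc f -> g = h.

Definition iso (X Y : A) (f : mor X Y) : Prop :=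
  exists g : mor Y X, g \oc f = idmor X /\ f \oc g = idmor Y.

(* [is_kernel i f]: i is a kernel of f; [is_cokernel p f]: p is a cokernel
   of f. *)
Definition is_kernel (K X Y : A) (i : mor K X) (f : mor X Y) : Prop :=
  f \oc i = 0 /\
  forall W (g : mor W X), f \oc g = 0 -> exists! h : mor W K, i \oc h = g.

Definition is_cokernel (X Y Q : A) (p : mor Y Q) (f : mor X Y) : Prop :=
  p \oc f = 0 /\
  forall W (g : mor Y W), g \oc f = 0 -> exists! h : mor Q W, h \oc p = g.

Definition is_biproduct (X Y S : A) (i1 : mor X S) (i2 : mor Y S)
    (p1 : mor S X) (p2 : mor S Y) : Prop :=
  [/\ p1 \oc i1 = idmor X, p2 \oc i2 = idmor Y, p1 \oc i2 = 0, p2 \oc i1 = 0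
    & i1 \oc p1 + i2 \oc p2 = idmor S].

Record abelian_category : Prop := Abelian {
  abelian_zero : exists Z : A, is_zero Z;
  abelian_biproduct : forall X Y : A,
    exists (S : A) (i1 : mor X S) (i2 : mor Y S) (p1 : mor S X) (p2 : mor S Y),
      is_biproduct i1 i2 p1 p2;
  abelian_kernel : forall (X Y : A) (f : mor X Y),
    exists (K : A) (i : mor K X), is_kernel i f;
  abelian_cokernel : forall (X Y : A) (f : mor X Y),
    exists (Q : A) (p : mor Y Q), is_cokernel p f;
  abelian_mono : forall (X Y : A) (f : mor X Y), mono f ->
    exists (Z : A) (g : mor Y Z), is_kernel f g;
  abelian_epi : forall (X Y : A) (f : mor X Y), epi f ->
    exists (Z : A) (g : mor Z X), is_cokernel f g
}.

Definition short_exact (X Y Z : A) (f : mor X Y) (g : mor Y Z) : Prop :=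
  is_kernel f g /\ is_cokernel g f.

Definition simple_object (S : A) : Prop :=
  ~ is_zero S /\
  forall (K : A) (m : mor K S), mono m -> is_zero K \/ iso m.

Inductive finite_length : A -> Prop :=
| finite_length_zero X : is_zero X -> finite_length X
| finite_length_ext X Y S (f : mor X Y) (g : mor Y S) :
    short_exact f g -> simple_object S -> finite_length X -> finite_length Y.

(* The index set may be infinite: no finiteness is imposed on a general
   semisimple abelian category. *)
Definition is_direct_sum (I : Type) (S : I -> A) (X : A)
    (inj : forall i, mor (S i) X) : Prop :=
  forall (Y : A) (g : forall i, mor (S i) Y),
    exists! h : mor X Y, forall i, h \oc inj i = g i.

Definition semisimple : Prop :=
  forall X : A, exists (I : Type) (S : I -> A) (inj : forall i, mor (S i) X),
    (forall i, simple_object (S i)) /\ is_direct_sum inj.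

End Abelian.

Definition locally_finite (k : fieldType) (C : linear_category k) : Prop :=
  (forall X Y : lob C,
     exists (n : nat) (f : {linear lhom X Y -> 'rV[k]_n}), bijective f) /\
  (forall X : C, finite_length X).

Record monoidal (A : preadditive) := Monoidal {
  tens : A -> A -> A;
  tensm : forall X X' Y Y' : A,
    mor X X' -> mor Y Y' -> mor (tens X Y) (tens X' Y');
  tens_unit : A;
  assoc : forall X Y Z, mor (tens (tens X Y) Z) (tens X (tens Y Z));
  assoc_inv : forall X Y Z, mor (tens X (tens Y Z)) (tens (tens X Y) Z);
  unitl : forall X, mor (tens tens_unit X) X;
  unitr : forall X, mor (tens X tens_unit) X;
  tensm_id : forall X Y, tensm (idmor X) (idmor Y) = idmor (tens X Y);
  tensm_comp : forall X X' X'' Y Y' Y''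
      (f' : mor X' X'') (f : mor X X') (g' : mor Y' Y'') (g : mor Y Y'),
    tensm (f' \oc f) (g' \oc g) = tensm f' g' \oc tensm f g;
  assocK : forall X Y Z, assoc_inv X Y Z \oc assoc X Y Z = idmor _;
  assocVK : forall X Y Z, assoc X Y Z \oc assoc_inv X Y Z = idmor _;
  unitl_iso : forall X, iso (unitl X);
  unitr_iso : forall X, iso (unitr X);
  assoc_natural : forall X X' Y Y' Z Z'
      (f : mor X X') (g : mor Y Y') (h : mor Z Z'),
    assoc X' Y' Z' \oc tensm (tensm f g) h
    = tensm f (tensm g h) \oc assoc X Y Z;
  unitl_natural : forall X Y (f : mor X Y),
    unitl Y \oc tensm (idmor tens_unit) f = f \oc unitl X;
  unitr_natural : forall X Y (f : mor X Y),
    unitr Y \oc tensm f (idmor tens_unit) = f \oc unitr X;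
  pentagon : forall W X Y Z,
    tensm (idmor W) (assoc X Y Z) \oc assoc W (tens X Y) Z
      \oc tensm (assoc W X Y) (idmor Z)
    = assoc W X (tens Y Z) \oc assoc (tens W X) Y Z;
  triangle : forall X Y,
    tensm (idmor X) (unitl Y) \oc assoc X tens_unit Y
    = tensm (unitr X) (idmor Y)
}.

Arguments tens {A} m X Y.
Arguments tensm {A} m {X X' Y Y'} f g.
Arguments tens_unit {A} m.
Arguments assoc {A} m X Y Z.
Arguments assoc_inv {A} m X Y Z.
Arguments unitl {A} m X.
Arguments unitr {A} m X.

Definition eq_mor (A : preadditive) (X Y : A) (e : X = Y) : mor X Y :=
  match e with erefl => idmor X end.

(* Strictness: the objects are equal on the nose and the constraints are
   identities, transported along these equalities. *)
Record strict (A : preadditive) (M : monoidal A) : Prop := Strict {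
  strict_assoc : forall X Y Z,
    exists e : tens M (tens M X Y) Z = tens M X (tens M Y Z),
      assoc M X Y Z = eq_mor e;
  strict_unitl : forall X,
    exists e : tens M (tens_unit M) X = X, unitl M X = eq_mor e;
  strict_unitr : forall X,
    exists e : tens M X (tens_unit M) = X, unitr M X = eq_mor e
}.

Section MonoidalProperties.
Variables (A : preadditive) (M : monoidal A).

Definition additive_tensor : Prop :=
  (forall (X X' Y Y' : A) (g : mor Y Y'),
     {morph (fun f : mor X X' => tensm M f g) : f f' / f + f'}) /\
  (forall (X X' Y Y' : A) (f : mor X X'),
     {morph (fun g : mor Y Y' => tensm M f g) : g g' / g + g'}).

Definition biexact_tensor : Prop :=
  forall (W X Y Z : A) (f : mor X Y) (g : mor Y Z), short_exact f g ->
    short_exact (tensm M (idmor W) f) (tensm M (idmor W) g) /\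
    short_exact (tensm M f (idmor W)) (tensm M g (idmor W)).

Definition abelian_monoidal : Prop := abelian_category A /\ additive_tensor.

(* The triangle identities are multiplied by the unit constraints, so that no
   inverse of these constraints is needed. *)
Definition is_left_dual (X X' : A)
    (ev : mor (tens M X' X) (tens_unit M))
    (coev : mor (tens_unit M) (tens M X X')) : Prop :=
  unitr M X \oc tensm M (idmor X) ev \oc assoc M X X' X
    \oc tensm M coev (idmor X) = unitl M X /\
  unitl M X' \oc tensm M ev (idmor X') \oc assoc_inv M X' X X'
    \oc tensm M (idmor X') coev = unitr M X'.

Definition has_left_duals : Prop :=
  forall X : A, exists (X' : A) (ev : mor (tens M X' X) (tens_unit M))
    (coev : mor (tens_unit M) (tens M X X')), is_left_dual ev coev.

End MonoidalProperties.

Section MultiringCategories.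
Variables (k : fieldType) (C : linear_category k) (M : monoidal C).

Definition bilinear_tensor : Prop :=
  (forall (X X' Y Y' : lob C) (g : lhom Y Y'),
     linear (fun f : lhom X X' =>
               @tensm C M X X' Y Y' f g : lhom (tens M X Y) (tens M X' Y'))) /\
  (forall (X X' Y Y' : lob C) (f : lhom X X'),
     linear (fun g : lhom Y Y' =>
               @tensm C M X X' Y Y' f g : lhom (tens M X Y) (tens M X' Y'))).

Record multiring_category : Prop := MultiringCategory {
  multiring_abelian : abelian_category C;
  multiring_locally_finite : locally_finite C;
  multiring_bilinear : bilinear_tensor;
  multiring_biexact : biexact_tensor M
}.

Definition scalar_end (a : k) : lhom (tens_unit M) (tens_unit M) :=
  a *: lidm (tens_unit M).

(* End(1) = k means that the canonical map k -> End(1) is bijective. *)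
Definition ring_category : Prop := multiring_category /\ bijective scalar_end.

End MultiringCategories.

(* The zero category satisfies every clause of [multiring_category], and there
   End(1) = 0 is not k. *)
Definition nonzero_category (A : preadditive) : Prop :=
  exists X : A, ~ is_zero X.

(* Additivity is not part of the definition. *)
Record functor (A B : preadditive) := Functor {
  fob :> A -> B;
  fmap : forall X Y : A, mor X Y -> mor (fob X) (fob Y);
  fmap_id : forall X, fmap (idmor X) = idmor (fob X);
  fmap_comp : forall X Y Z (g : mor Y Z) (f : mor X Y),
    fmap (g \oc f) = fmap g \oc fmap f
}.

Arguments fmap {A B} F {X Y} f : rename.

Definition fully_faithful (A B : preadditive) (F : functor A B) : Prop :=
  forall X Y : A, bijective (fun f : mor X Y => fmap F f).

(* The associators, identities in the strict case, make [lax_assoc] typecheck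
   without rewriting along equalities of objects. *)
Record lax_monoidal_functor (A B : preadditive)
    (MA : monoidal A) (MB : monoidal B) := LaxMonoidalFunctor {
  lax_functor :> functor A B;
  lax_tens : forall X Y : A,
    mor (tens MB (lax_functor X) (lax_functor Y)) (lax_functor (tens MA X Y));
  lax_unit : mor (tens_unit MB) (lax_functor (tens_unit MA));
  lax_tens_natural : forall (X X' Y Y' : A) (f : mor X X') (g : mor Y Y'),
    fmap lax_functor (tensm MA f g) \oc lax_tens X Y
    = lax_tens X' Y' \oc tensm MB (fmap lax_functor f) (fmap lax_functor g);
  lax_assoc : forall X Y Z : A,
    lax_tens X (tens MA Y Z)
      \oc tensm MB (idmor (lax_functor X)) (lax_tens Y Z)
      \oc assoc MB (lax_functor X) (lax_functor Y) (lax_functor Z)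
    = fmap lax_functor (assoc MA X Y Z)
      \oc lax_tens (tens MA X Y) Z
      \oc tensm MB (lax_tens X Y) (idmor (lax_functor Z));
  lax_unitl : forall X : A,
    unitl MB (lax_functor X)
    = fmap lax_functor (unitl MA X) \oc lax_tens (tens_unit MA) X
      \oc tensm MB lax_unit (idmor (lax_functor X));
  lax_unitr : forall X : A,
    unitr MB (lax_functor X)
    = fmap lax_functor (unitr MA X) \oc lax_tens X (tens_unit MA)
      \oc tensm MB (idmor (lax_functor X)) lax_unit
}.

(* Main.v *)
Require Import Defs.
From HB Require Import structures.
From mathcomp Require Import all_boot all_order all_algebra.

(** The unit object [1'] of [D] is simple, so the epimorphism from [1'] to
    [F 1] given by the lax unit is either zero or invertible
    ([epi_simple_source]).  If it is zero then [F 1] has zero identity; by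
    faithfulness the same holds for [1], and tensoring with [1] kills every
    object of [C] ([zero_category_of_zero_unit]), which is excluded.  So it is
    invertible, and Schur's lemma, transported along it, says that every
    endomorphism of [F 1] is zero or invertible.  A fully faithful functor
    gives an isomorphism of multiplicative monoids from [End 1] to
    [End (F 1)], which preserves zero because zero is the absorbing element
    of each monoid.  Thus [End 1] is a division algebra,
    finite-dimensional over the algebraically closed field [k]: left
    composition with an endomorphism [f] of [1] has an eigenvector [g]
    ([linear_eigenvector]), and cancelling the invertible [g] from
    [f \oc g = a *: g] leaves [f = a *: id]. *)

Set Implicit Arguments.
Unset Strict Implicit.
Unset Printing Implicit Defensive.

Import GRing.Theory.
Local Open Scope ring_scope.

Section Preadditive.
Variable A : preadditive.
Implicit Types X Y Z S T : A.

Lemma comp0m X Y Z (f : mor X Y) : (0 : mor Y Z) \oc f = 0.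
Proof. by apply: (addrI ((0 : mor Y Z) \oc f)); rewrite -compmDl !addr0. Qed.

Lemma compm0 X Y Z (g : mor Y Z) : g \oc (0 : mor X Y) = 0.
Proof. by apply: (addrI (g \oc 0)); rewrite -compmDr !addr0. Qed.

Lemma compmN X Y Z (g : mor Y Z) (f : mor X Y) : g \oc (- f) = - (g \oc f).
Proof. by apply: (addrI (g \oc f)); rewrite -compmDr !subrr compm0. Qed.

Lemma is_zero_id0 X : idmor X = 0 -> is_zero X.
Proof.
move=> X0 Y; split=> f.
  by rewrite -(comp1m f) X0 comp0m.
by rewrite -(compm1 f) X0 compm0.
Qed.

Lemma mono_kernel_zero K X Y (i : mor K X) (f : mor X Y) :
  is_kernel i f -> is_zero K -> mono f.
Proof.
move=> [_ kerf] K0 W g h fgh; apply/eqP; rewrite -subr_eq0; apply/eqP.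
have /kerf[u [<- _]] : f \oc (g - h) = 0 by rewrite compmDr compmN fgh subrr.
by rewrite ((K0 W).1 u) compm0.
Qed.

Lemma mono_epi_iso X Y (f : mor X Y) :
  abelian_category A -> mono f -> epi f -> iso f.
Proof.
move=> abA mono_f epi_f; have [Z [g [fg0 cokg]]] := abelian_epi abA epi_f.
have g0 : g = 0 by apply: mono_f; rewrite fg0 compm0.
have /cokg[h [hf _]] : idmor X \oc g = 0 by rewrite g0 compm0.
exists h; split=> //; apply: epi_f.
by rewrite -compmA hf compm1 comp1m.
Qed.

(** A morphism out of a simple object is governed by its kernel, which is
    either everything or zero. *)
Lemma mor_simple_source S Y (f : mor S Y) :
  abelian_category A -> simple_object S -> f = 0 \/ mono f.
Proof.
move=> abA [_ simS]; have [K [i keri]] := abelian_kernel abA f.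
have mono_i : mono i.
  move=> W g h igh; have fig0 : f \oc (i \oc g) = 0.
    by rewrite compmA keri.1 comp0m.
  have [u [_ uniq_u]] := keri.2 _ _ fig0.
  by rewrite -(uniq_u g erefl) -(uniq_u h (esym igh)).
case: (simS _ _ mono_i) => [K0 | [j [_ ij1]]].
  by right; apply: mono_kernel_zero keri K0.
by left; rewrite -(compm1 f) -ij1 compmA keri.1 comp0m.
Qed.

Lemma epi_simple_source S Y (f : mor S Y) :
  abelian_category A -> simple_object S -> epi f -> f = 0 \/ iso f.
Proof.
move=> abA simS epi_f; case: (mor_simple_source f abA simS); first by left.
by move=> mono_f; right; apply: mono_epi_iso.
Qed.

(** Schur's lemma. *)
Lemma schur S (f : mor S S) :
  abelian_category A -> simple_object S -> f = 0 \/ iso f.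
Proof.
move=> abA simS; case: (mor_simple_source f abA simS); first by left.
move=> /simS.2[S0 | iso_f]; first by case: simS.1.
by right.
Qed.

(** Conjugation by an isomorphism [u] carries Schur's lemma over to [T]. *)
Lemma schur_iso S T (u : mor S T) (f : mor T T) :
  abelian_category A -> simple_object S -> iso u -> f = 0 \/ iso f.
Proof.
move=> abA simS [v [vu1 uv1]].
have f_conj : f = u \oc (v \oc f \oc u) \oc v.
  by rewrite !compmA uv1 comp1m -compmA uv1 compm1.
case: (schur (v \oc f \oc u) abA simS) => [conj0 | [g [gf1 fg1]]].
  by left; rewrite f_conj conj0 compm0 comp0m.
right; exists (u \oc g \oc v); rewrite {1 2}f_conj.
have conjM h h' : u \oc h \oc v \oc (u \oc h' \oc v) = u \oc (h \oc h') \oc v.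
  by rewrite !compmA -(compmA (u \oc h) v u) vu1 compm1.
by rewrite !conjM gf1 fg1 compm1 uv1.
Qed.

End Preadditive.

Section FullyFaithful.
Variables (A B : preadditive) (F : functor A B).
Hypothesis F_ff : fully_faithful F.

(** The zero endomorphism is the absorbing element of the endomorphism monoid;
    by fullness [fmap F 0] absorbs every endomorphism of [F X], zero
    included. *)
Lemma fmap0 (X : A) : fmap F (0 : mor X X) = 0.
Proof.
have [G _ GK] := F_ff X X.
have F0 := fmap_comp F (0 : mor X X) (G 0).
by rewrite comp0m GK compm0 in F0.
Qed.

Lemma fmap_eq0 (X : A) (f : mor X X) : fmap F f = 0 -> f = 0.
Proof. by rewrite -fmap0 => /(bij_inj (F_ff X X)). Qed.

Lemma iso_fmap (X Y : A) (f : mor X Y) : iso (fmap F f) -> iso f.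
Proof.
move=> [g [gf1 fg1]]; have [G _ GK] := F_ff Y X.
exists (G g); split.
  by apply: (bij_inj (F_ff X X)); rewrite fmap_comp GK fmap_id.
by apply: (bij_inj (F_ff Y Y)); rewrite fmap_comp GK fmap_id.
Qed.

End FullyFaithful.

(** Every object [X] is isomorphic to [1 (x) X], whose identity is the tensor
    product of the vanishing identity of [1] with that of [X]. *)
Lemma zero_category_of_zero_unit (k : fieldType) (C : linear_category k)
    (M : monoidal C) :
  bilinear_tensor M -> idmor (tens_unit M) = 0 -> ~ nonzero_category C.
Proof.
move=> [linl _] unit0 [X]; apply; apply: is_zero_id0.
have [l [_ l1]] := unitl_iso M X.
have tens0 : idmor (tens M (tens_unit M) X) = 0.
  (* linearity at (-1) *: 0 + 0 says that tensoring with 0 gives 0 *)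
  have := linl (tens_unit M) (tens_unit M) X X (idmor X) (-1) 0 0.
  by rewrite scaler0 addr0 scaleN1r addNr -tensm_id unit0.
by rewrite -l1 -(compm1 (unitl M X)) tens0 compm0 comp0m.
Qed.

(** In coordinates the operator is a matrix of positive size, whose
    characteristic polynomial has a root. *)
Lemma linear_eigenvector (k : closedFieldType) (V : lmodType k) (n : nat)
    (c : {linear V -> 'rV[k]_n}) (L : {linear V -> V}) (x : V) :
  bijective c -> x != 0 -> exists (a : k) (v : V), v != 0 /\ L v = a *: v.
Proof.
move=> [d cK dK] x0.
have n_gt0 : (0 < n)%N.
  rewrite lt0n; apply/eqP => n0; case/eqP: x0.
  move: c d cK {dK}; rewrite n0 => c d cK.
  by rewrite -(cK x) thinmx0 -(thinmx0 (c 0)) cK.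
have lin_d : linear d := can2_linear cK dK.
have lin_M : linear (c \o L \o d).
  by move=> a u v /=; rewrite lin_d !linearP.
pose isL := GRing.isLinear.Build _ _ _ _ _ lin_M.
pose M : {linear 'rV[k]_n -> 'rV[k]_n} := HB.pack (c \o L \o d) isL.
have /closed_rootP[a] : size (char_poly (lin1_mx M)) != 1%N.
  by rewrite size_char_poly eqSS -lt0n.
rewrite -eigenvalue_root_char => /eigenvalueP[v].
rewrite mul_rV_lin1 /= => Mv v0.
exists a, (d v); split; last by apply: (can_inj cK); rewrite linearZ dK.
by apply: contra v0 => /eqP dv0; rewrite -(dK v) dv0 linear0.
Qed.

(** Left composition with [f] has an eigenvector [g], with eigenvalue [a];
    since [g] is nonzero it is invertible, and composing [f \oc g = a *: g]
    with its inverse identifies [f] as the scalar [a]. *)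
Lemma division_end_scalar (k : closedFieldType) (C : linear_category k)
    (X : lob C) :
  locally_finite C -> lidm X != 0 ->
  (forall f : @mor C X X, f = 0 \/ iso f) ->
  bijective (fun a : k => a *: lidm X).
Proof.
move=> [homfin _] id0 div; have [n [c bij_c]] := homfin X X.
have scalarP (f : lhom X X) : exists a, f == a *: lidm X.
  pose isL := GRing.isLinear.Build _ _ _ _ _ (@lcomp_linearr k C X X X f).
  pose L : {linear lhom X X -> lhom X X} := HB.pack (lcomp f) isL.
  have [a [g [g0 /= fg]]] := linear_eigenvector L bij_c id0.
  exists a; apply/eqP; case: (div g) => [g_eq0 | [h [_ gh1]]].
    by rewrite g_eq0 eqxx in g0.
  have scale_compl u v : lcomp (a *: u : lhom X X) (v : lhom X X)
      = a *: lcomp u v.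
    have := @lcomp_linearl k C X X X v a u 0.
    by rewrite addr0 (@comp0m C X X X v : lcomp 0 v = 0) addr0.
  by rewrite -[LHS]lcompm1 -[lidm X]gh1 [LHS]lcompA fg scale_compl.
exists (fun f => xchoose (scalarP f)) => [a | f]; last first.
  by rewrite -(eqP (xchooseP (scalarP f))).
have := xchooseP (scalarP (a *: lidm X)); rewrite -subr_eq0 -scalerBl.
by rewrite scaler_eq0 (negbTE id0) orbF subr_eq0 => /eqP.
Qed.

Theorem proposition6p5
  (k : closedFieldType)
  (C : linear_category k) (MC : monoidal C)
  (MC_strict : strict MC)
  (C_multiring : multiring_category MC)
  (C_semisimple : semisimple C)
  (C_duals : has_left_duals MC)
  (C_nonzero : nonzero_category C)
  (D : preadditive) (MD : monoidal D)
  (MD_strict : strict MD)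
  (D_abelian : abelian_monoidal MD)
  (D_semisimple : semisimple D)
  (D_biexact : biexact_tensor MD)
  (D_unit_simple : simple_object (tens_unit MD))
  (F : lax_monoidal_functor MC MD)
  (F_ff : fully_faithful F)
  (F_unit_epi : epi (lax_unit F)) :
  ring_category MC.
Proof.
have id0 : idmor (tens_unit MC) != 0.
  apply/eqP => unit0.
  have bilin := multiring_bilinear C_multiring.
  exact: (zero_category_of_zero_unit bilin unit0).
have fin_C := multiring_locally_finite C_multiring.
split=> //; apply: (division_end_scalar fin_C id0).
move=> f; have abD := D_abelian.1.
case: (epi_simple_source abD D_unit_simple F_unit_epi) => [phi0 | iso_phi].
  (* the identity of [F 1] and 0 agree after the epimorphism 0 *)
  case/eqP: id0; apply: (fmap_eq0 F_ff); rewrite fmap_id.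
  by apply: F_unit_epi; rewrite phi0 !compm0.
case: (schur_iso (fmap F f) abD D_unit_simple iso_phi).
  by left; apply: (fmap_eq0 F_ff).
by right; apply: (iso_fmap F_ff).
Qed.
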